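(* There exists a branchwise-real tree order which is not continuously gradable.
   Context: A tree order is a partial order $X$ with a minimum element (its root) such that for every $x\in X$ the set $\{y\in X\mid y\le x\}$ is linearly ordered. A branch of $X$ is a maximal linearly ordered subset. A branchwise-real tree order is a tree order in which every branch is order-isomorphic to a real interval and in which any two elements $x,y$ have a greatest lower bound $x\wedge y$. An $\mathbb{R}$-grading of $X$ is a strictly monotonic map $\ell\colon X\to\mathbb{R}$ (i.e. $x<y$ implies $\ell(x)<\ell(y)$). It is continuous if for all $x<y$ in $X$, the restriction of $\ell$ to $[x,y]=\{z\in X\mid x\le z\le y\}$ is an order-isomorphism onto the real interval $[\ell(x),\ell(y)]$. $X$ is continuously gradable if it admits a continuous $\mathbb{R}$-grading. *)

(* Defs.v *)
From mathcomp Require Import all_boot all_order all_algebra.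
From mathcomp Require Import boolp classical_sets functions set_interval reals.

Set Implicit Arguments.
Unset Strict Implicit.
Unset Printing Implicit Defensive.

Import Order.TTheory.

Local Open Scope classical_set_scope.
Local Open Scope order_scope.

Section OrderIso.
Context (d d' : Order.disp_t) (T : porderType d) (U : porderType d').

Definition order_iso_on (A : set T) (B : set U) (f : T -> U) : Prop :=
  set_bij A B f /\ {in A &, {mono f : x y / x <= y}}.

End OrderIso.

Section TreeOrder.
Context (d : Order.disp_t) (X : porderType d).

Definition linearly_ordered (A : set X) : Prop :=
  total_on A (fun x y => x <= y).

Definition tree_order : Prop :=
  (exists r : X, forall x, r <= x) /\
  (forall x : X, linearly_ordered [set y | y <= x]).

Definition branch (B : set X) : Prop :=
  linearly_ordered B /\
  forall C : set X, linearly_ordered C -> B `<=` C -> C = B.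

(* [interval R] has open, closed and infinite bounds on either side; degenerate
   intervals are included, so the one-point tree is branchwise-real. *)
Definition branchwise_real (R : realType) : Prop :=
  [/\ tree_order,
      (forall B : set X, branch B ->
         exists (i : interval R) (f : X -> R), order_iso_on B [set` i] f) &
      (forall x y : X, exists m : X, infimums [set x; y] m)].

Definition grading (R : realType) (l : X -> R) : Prop :=
  {homo l : x y / x < y}.

Definition continuous_grading (R : realType) (l : X -> R) : Prop :=
  grading l /\
  forall x y : X, x < y ->
    order_iso_on [set` `[x, y]] [set` `[l x, l y]] l.

Definition continuously_gradable (R : realType) : Prop :=
  exists l : X -> R, continuous_grading l.

End TreeOrder.

(* Main.v *)
(* Kurepa: no strictly increasing map F goes from the well-ordered subsets of
   the reals, ordered by end-extension, to the reals. Otherwise the sets A with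
   a = F {b in A | b < a} for all a in A form a chain; if U is its union, then
   F U can be added to U, so F U < F U.
   Filling each edge of that tree with a real segment gives a branchwise-real
   tree X: a branch belongs to a single well-ordered set U of reals, and the
   edge into the next element of U after an initial segment B is sent onto the
   gap between sup B and that element. A grading of X, squeezed into a bounded
   interval, would restrict to a map F as above, so X has no grading at all,
   continuous or not. The label sets are required to be left-discrete so that
   these gaps are nondegenerate. *)
Require Import Defs.
From HB Require Import structures.
From mathcomp Require Import all_boot all_order all_algebra.
From mathcomp Require Import boolp classical_sets functions set_interval reals.
From mathcomp Require Import constructive_ereal lra.

Set Implicit Arguments.
Unset Strict Implicit.
Unset Printing Implicit Defensive.

Import Order.TTheory GRing.Theory Num.Theory.

Local Open Scope classical_set_scope.
Local Open Scope ring_scope.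

(** * Initial segments and well-ordered sets of reals *)

Section InitialSegments.
Context (R : realType).
Implicit Types A B C S : set R.

Definition initial B C := B `<=` C /\ forall b c, B b -> C c -> c <= b -> B c.

Lemma initial_refl B : initial B B.
Proof. by split. Qed.

Lemma initial_trans B C A : initial B C -> initial C A -> initial B A.
Proof.
move=> [BC iB] [CA iC]; split=> [x /BC /CA //|b c Bb Ac cb].
by apply: (iB b) => //; apply: (iC b) => //; apply: BC.
Qed.

Lemma initial_anti B C : initial B C -> initial C B -> B = C.
Proof. by move=> [BC _] [CB _]; apply/seteqP. Qed.

Lemma initial0 C : initial set0 C.
Proof. by split. Qed.

Lemma initial_total A B C :
  initial B A -> initial C A -> initial B C \/ initial C B.
Proof.
move=> [BA iB] [CA iC]; have [BC|] := pselect (B `<=` C).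
  by left; split=> // b c Bb Cc; apply: iB => //; apply: CA.
move=> /existsNP[b /not_implyP[Bb nCb]]; right.
have CB : C `<=` B.
  move=> c Cc; apply: (iB b) => //; first exact: CA.
  by rewrite leNgt; apply/negP => /ltW bc; apply/nCb/(iC c)/bc => //; apply: BA.
by split=> // c d Cc Bd; apply: iC => //; apply: BA.
Qed.

Definition below A a := A `&` [set x | x < a].

Lemma initial_below A a : initial (below A a) A.
Proof.
by split=> [x []//|b c [_ /= ba] Ac cb]; split=> //=; apply: le_lt_trans ba.
Qed.

(** Conditions on [below A a], such as left-discreteness or [a = F (below A a)], thus pass between a
    set and its initial segments. *)
Lemma below_initial B A a : initial B A -> B a -> below A a = below B a.
Proof.
move=> [BA iB] Ba; apply/seteqP; split=> x [? /= xa]; split=> //.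
  by apply: (iB a) => //; apply: ltW.
exact: BA.
Qed.

Definition wo A := forall S, S `<=` A -> S !=set0 ->
  exists2 m, S m & lbound S m.

(* Left-discreteness (every element is far from the smaller ones) makes room
   for an edge between any proper initial segment and the next element; the
   upper bound 3 leaves room for a last edge, ending at position 4. *)
Definition admissible A :=
  [/\ wo A, forall a, A a -> 0 < a <= 3 &
      forall a, A a -> exists2 c, c < a & ubound (below A a) c].

Lemma admissible0 : admissible set0.
Proof. by split=> // S S0 [x /S0]. Qed.

Lemma admissible_sub B A : B `<=` A -> admissible A -> admissible B.
Proof.
move=> BA [woA A3 ldA]; split=> [S SB|a /BA /A3 //|a /BA /ldA[c ca Ac]].
  by apply: woA => x /SB /BA.
by exists c => // x [/BA Ax xa]; apply: Ac.
Qed.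

(** The largest common initial segment, possibly smaller than the intersection. *)
Definition agree B C :=
  [set x | [/\ B x, C x & forall z, z <= x -> B z <-> C z]].

Lemma agreeC B C : agree B C = agree C B.
Proof.
apply/seteqP; split=> x [Bx Cx BC]; split=> // z /BC zBC; exact: iff_sym zBC.
Qed.

Lemma initial_agree B C : initial (agree B C) B.
Proof.
split=> [x []//|b c [Bb Cb BC] Bc cb].
split=> // [|z zc]; first exact/BC.
by apply: BC; apply: le_trans cb.
Qed.

Lemma initial_agree_max B C A : initial A B -> initial A C ->
  initial A (agree B C).
Proof.
move=> [AB iAB] [AC iAC]; split=> [x Ax|a c Aa [Bc _ _]]; last exact: iAB.
split; [exact: AB|exact: AC|move=> z zx; split=> ?].
  by apply/AC/(iAB x).
by apply/AB/(iAC x).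
Qed.

(* The two sets could only split at labels that both equal [F (agree A B)]. *)
Lemma generated_total (F : set R -> R) A B : wo A -> wo B ->
  (forall a, A a -> a = F (below A a)) ->
  (forall b, B b -> b = F (below B b)) ->
  initial A B \/ initial B A.
Proof.
have next E G : wo E -> (forall a, E a -> a = F (below E a)) ->
    ~ initial E G ->
    exists a, [/\ E a, ~ agree E G a, below E a = agree E G &
                  a = F (agree E G)].
  move=> woE genE nEG; have iD := initial_agree E G.
  have nED : ~ E `<=` agree E G.
    move=> ED; apply: nEG; have -> : E = agree E G.
      by apply/seteqP; split=> //; case: iD.
    by rewrite agreeC; apply: initial_agree.
  have [||a [Ea nDa] amin] := woE (E `\` agree E G).
  - by move=> x [].
  - by move/existsNP: nED => [x /not_implyP[Ex nDx]]; exists x.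
  have belowE : below E a = agree E G.
    apply/seteqP; split=> x.
      move=> [Ex /= xa]; apply: contrapT => nDx.
      by have := amin x (conj Ex nDx); rewrite leNgt xa.
    move=> Dx; split; first by case: Dx.
    rewrite /= ltNge; apply/negP => ax; apply: nDa.
    by case: iD => _; apply; [exact: Dx| |].
  by exists a; split=> //; rewrite -belowE; apply: genE.
move=> woA woB genA genB.
have [?|nAB] := pselect (initial A B); first by left.
have [?|nBA] := pselect (initial B A); first by right.
have [a [Aa nDa belowA aF]] := next _ _ woA genA nAB.
have [b [Bb _ belowB bF]] := next _ _ woB genB nBA.
have ab : a = b by rewrite aF bF agreeC.
(* The common value lies in both sets, which coincide below it, so it belongs to [agree A B] after
   all. *)
case: nDa; split=> //; first by rewrite ab.
move=> z; rewrite le_eqVlt => /orP[/eqP->|za]; first by rewrite {2}ab.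
split=> [Az|Bz].
  have : below A a z by [].
  by rewrite belowA => -[].
have : below B b z by rewrite -ab.
by rewrite belowB => -[].
Qed.

(** * Unions of chains under end-extension *)

Section Chain.
Context (P : set (set R)).
Hypothesis P_total : forall A B, P A -> P B -> initial A B \/ initial B A.

Lemma initial_bigcup A : P A -> initial A (\bigcup_(B in P) B).
Proof.
move=> PA; split=> [x Ax|a c Aa [B PB Bc] ca]; first by exists A.
by have [[_]|[+ _]] := P_total PA PB; [apply; first exact: Aa|apply].
Qed.

(** A least element found inside one member is least overall, as that member is initial in the
    union. *)
Lemma wo_bigcup : (forall A, P A -> wo A) -> wo (\bigcup_(B in P) B).
Proof.
move=> Pwo S SU [s Ss]; have [A PA As] := SU s Ss.
have [| |m [Sm Am] mmin] := Pwo A PA (S `&` A); [by move=> x []|by exists s|].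
exists m => // x Sx; rewrite leNgt; apply/negP => xm.
have Ax : A x.
  by have [_] := initial_bigcup PA; apply; [exact: Am|exact: SU|exact: ltW].
by have := mmin x (conj Sx Ax); rewrite leNgt xm.
Qed.

Lemma admissible_bigcup : (forall A, P A -> admissible A) ->
  admissible (\bigcup_(B in P) B).
Proof.
move=> Padm; split.
- by apply: wo_bigcup => A /Padm[].
- by move=> a [A /Padm[_ + _]]; apply.
- move=> a [A PA Aa]; have [_ _ /(_ a Aa)] := Padm A PA.
  by rewrite (below_initial (initial_bigcup PA)).
Qed.

End Chain.

(** * Suprema, and the gap after an initial segment *)

Lemma admissible_ub A : admissible A -> has_ubound A.
Proof. by move=> [_ A3 _]; exists 3 => a /A3 /andP[]. Qed.

Lemma admissible_sup_ge A b : admissible A -> A b -> b <= sup A.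
Proof. by move=> /admissible_ub/ub_le_sup; apply. Qed.

(** The assumption [0 <= c] serves the empty set, whose [sup] is [0]. *)
Lemma sup_le_nonneg A c : 0 <= c -> ubound A c -> sup A <= c.
Proof.
move=> c0 Ac; have [A0|] := pselect (A !=set0); first exact: ge_sup.
by move/nonemptyPn => ->; rewrite sup0.
Qed.

Lemma admissible_sup_ge0 A : admissible A -> 0 <= sup A.
Proof.
move=> admA; have [[a Aa]|] := pselect (A !=set0).
  apply: le_trans (admissible_sup_ge admA Aa).
  by case: admA => _ /(_ a Aa)/andP[/ltW].
by move/nonemptyPn => ->; rewrite sup0.
Qed.

Lemma admissible_sup_le3 A : admissible A -> sup A <= 3.
Proof. by move=> [_ A3 _]; apply: sup_le_nonneg => // a /A3 /andP[]. Qed.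

(* [4] stands for the end of the branch: it is returned when [B = U]. *)
Definition next U B : R := xget 4 [set m | (U `\` B) m /\ lbound (U `\` B) m].

Lemma next_out U : next U U = 4.
Proof. by rewrite /next; case: xgetP => // x _ [] []. Qed.

Lemma nextP U B : wo U -> initial B U -> B <> U ->
  [/\ U (next U B), ~ B (next U B) & lbound (U `\` B) (next U B)].
Proof.
move=> woU [BU _] nBU.
have [| |m Sm mmin] := woU (U `\` B); first by move=> x [].
  apply/set0P/eqP => UB; apply: nBU; apply/seteqP; split=> //.
  by rewrite -setD_eq0.
by rewrite /next; case: xgetP => [x _ [[]]//|/(_ m)[]].
Qed.

(** Left-discreteness of [U] at the next label gives the gap; if [B = U], it is the gap between [3]
    and [4]. *)
Lemma sup_lt_next U B : admissible U -> initial B U -> sup B < next U B.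
Proof.
move=> admU iBU.
have [->|nBU] := pselect (B = U).
  by rewrite next_out; have := admissible_sup_le3 admU; lra.
have [woU U3 ldU] := admU; have [Un nBn _] := nextP woU iBU nBU.
have [c cn Uc] := ldU _ Un.
have n0 : 0 < next U B by case/andP: (U3 _ Un).
apply: (@le_lt_trans _ _ (Num.max 0 c)); last by rewrite gt_max n0.
apply: sup_le_nonneg => [|b Bb]; rewrite le_max ?lexx //.
apply/orP; right; apply: Uc; split; first by case: iBU; auto.
rewrite /= ltNge; apply/negP => nb; apply: nBn.
by case: iBU => _; apply; [exact: Bb| |].
Qed.

(** Some element of [C] outside [B] is at least the next label, and [C] is closed downwards in
    [U]. *)
Lemma next_initial U B C : admissible U -> initial B C -> initial C U ->
  B <> C -> C (next U B).
Proof.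
move=> [woU _ _] iBC iCU nBC.
have nBU : B <> U by move=> BU; subst; apply/nBC/initial_anti.
have [Un nBn nmin] := nextP woU (initial_trans iBC iCU) nBU.
have [c [Cc nBc]] : exists c, (C `\` B) c.
  apply/set0P/eqP => CB; apply: nBC; apply/seteqP; split; first by case: iBC.
  by rewrite -setD_eq0.
have [CU iC] := iCU.
by apply: (iC c) => //; apply: nmin; split=> //; apply: CU.
Qed.

End InitialSegments.

#[local] Hint Resolve initial_refl : core.

(** * The tree of labelled edges: order, root and meets *)

Section Tree.
Context (R : realType).
Implicit Types A B C U : set R.

(* [(A, t)] lies at fraction [t] of the edge that leads to the branching point
   [(A, 1)]; that edge starts at [(A, 0)] exactly when [A] has no maximum. *)
Definition valid (x : set R * R) :=
  [/\ admissible x.1, 0 <= x.2 <= 1 & x.1 (sup x.1) -> 0 < x.2].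

Definition point := {x : set R * R | `[< valid x >]}.
HB.instance Definition _ := Choice.on point.
Implicit Types x y z : point.

Definition labels x := (val x).1.
Definition height x := (val x).2.

Lemma pointP x : valid (labels x, height x).
Proof. by have /asboolP := valP x; rewrite /labels /height; case: (val x). Qed.

Lemma point_eq x y : labels x = labels y -> height x = height y -> x = y.
Proof.
move=> xy1 xy2; apply: val_inj; move: xy1 xy2; rewrite /labels /height.
by case: (val x) (val y) => [? ?] [? ?] /= -> ->.
Qed.

Lemma admissible_labels x : admissible (labels x).
Proof. by case: (pointP x). Qed.

Lemma height_ge0 x : 0 <= height x.
Proof. by case: (pointP x) => _ /andP[]. Qed.

Lemma height_le1 x : height x <= 1.
Proof. by case: (pointP x) => _ /andP[]. Qed.

Lemma exists_point A (t : R) : admissible A -> 0 <= t <= 1 ->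
  (A (sup A) -> 0 < t) -> exists x, labels x = A /\ height x = t.
Proof.
move=> admA t01 At.
have At_valid : `[< valid (A, t) >] by apply/asboolP.
by exists (exist _ (A, t) At_valid).
Qed.

Lemma exists_point1 A : admissible A -> exists x, labels x = A /\ height x = 1.
Proof. by move=> admA; apply: exists_point => //; rewrite ler01 lexx. Qed.

Definition point_le x y := `[< initial (labels x) (labels y) /\
  (labels x = labels y -> height x <= height y) >].

Lemma point_le_refl : reflexive point_le.
Proof. by move=> x; apply/asboolP; split. Qed.

Lemma point_le_anti : antisymmetric point_le.
Proof.
move=> x y /andP[/asboolP[ixy hxy] /asboolP[iyx hyx]].
have xy := initial_anti ixy iyx.
by apply: point_eq => //; apply: le_anti; rewrite hxy // hyx.
Qed.

Lemma point_le_trans : transitive point_le.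
Proof.
move=> y x z /asboolP[ixy hxy] /asboolP[iyz hyz]; apply/asboolP; split.
  exact: initial_trans iyz.
move=> xz; have xy : labels x = labels y.
  by apply: initial_anti => //; rewrite xz.
by apply: le_trans (hxy xy) (hyz _); rewrite -xy.
Qed.

Fact point_display : Order.disp_t. Proof. exact: Order.Disp tt tt. Qed.

HB.instance Definition _ := Order.Le_isPOrder.Build point_display point
  point_le_refl point_le_anti point_le_trans.

Lemma point_leP x y : reflect (initial (labels x) (labels y) /\
  (labels x = labels y -> height x <= height y)) (x <= y)%O.
Proof. exact: asboolP. Qed.

Lemma le_of_neq x y : initial (labels x) (labels y) -> labels x <> labels y ->
  (x <= y)%O.
Proof. by move=> ixy nxy; apply/point_leP. Qed.

Lemma comparable_labels x y :
  initial (labels x) (labels y) \/ initial (labels y) (labels x) ->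
  (x <= y)%O \/ (y <= x)%O.
Proof.
have [exy _|nxy] := pselect (labels x = labels y).
  have [hxy|/ltW hyx] := leP (height x) (height y).
    by left; apply/point_leP; rewrite exy.
  by right; apply/point_leP; rewrite exy.
by case=> ?; [left|right]; apply: le_of_neq => // /esym.
Qed.

Lemma point_tree_order : tree_order point.
Proof.
split=> [|x y z /point_leP[iy _] /point_leP[iz _]].
  (* The root is the start of the edge with empty label set. *)
  have [|//|r [r1 r2]] := @exists_point set0 0 (@admissible0 R).
    by rewrite lexx ler01.
  exists r => x; apply/point_leP; rewrite r1 r2.
  by split=> [|_]; [exact: initial0|exact: height_ge0].
exact/comparable_labels/(initial_total iy iz).
Qed.

(** Incomparable points part at the branching point of their largest common initial segment. *)
Lemma point_meet x y : exists m, infimums [set x; y] m.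
Proof.
have inf_le u v : (u <= v)%O -> infimums [set u; v] u.
  by move=> uv; split=> [w [->|->]|w]; [|done|apply; left].
have [/inf_le ?|nxy] := pselect ((x <= y)%O); first by exists x.
have [/inf_le ?|nyx] := pselect ((y <= x)%O).
  by exists y; rewrite setUC.
have iD u v : initial (agree (labels u) (labels v)) (labels u).
  exact: initial_agree.
have [|m [m1 m2]] := @exists_point1 (agree (labels x) (labels y)).
  by apply: admissible_sub (admissible_labels x); case: (iD x y).
exists m; split.
  have le_m u v : labels m = agree (labels u) (labels v) ->
      ~ (u <= v)%O -> ~ (v <= u)%O -> (m <= u)%O.
    move=> mE nuv nvu; apply: le_of_neq; rewrite mE; first exact: iD.
    move=> uE.
    suff: initial (labels u) (labels v).
      by move=> /or_introl/comparable_labels[].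
    by rewrite -uE agreeC; apply: iD.
  by move=> z [->|->]; [apply: (le_m x y)|apply: (le_m y x); rewrite // agreeC].
move=> z zxy; have /point_leP[izx _] := zxy x (or_introl erefl).
have /point_leP[izy _] := zxy y (or_intror erefl).
apply/point_leP; rewrite m1 m2; split; first exact: initial_agree_max.
by move=> _; apply: height_le1.
Qed.

(** The label sets along [D] form a chain; the branching point of their union lies above all of [D],
    so maximality applies. *)
Lemma branch_downset (D : set point) : branch D ->
  exists u, height u = 1 /\ D = [set x | (x <= u)%O].
Proof.
move=> [linD maxD]; pose P := labels @` D.
have P_total A B : P A -> P B -> initial A B \/ initial B A.
  move=> [x Dx <-] [y Dy <-].
  by have [/point_leP[]|/point_leP[]] := linD x y Dx Dy; [left|right].
have [|u [u1 u2]] := @exists_point1 (\bigcup_(B in P) B).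
  by apply: admissible_bigcup => // A [x _ <-]; apply: admissible_labels.
exists u; split=> //; apply/esym/maxD; first by case: point_tree_order.
move=> x Dx /=; apply/point_leP; rewrite u1 u2.
split; last by move=> _; apply: height_le1.
by apply: initial_bigcup => //; exists x.
Qed.

(** * Isomorphism of a branch with the interval from [0] to [4] *)

Section Position.
Context (u : point).
Hypothesis height_u : height u = 1.
Let U := labels u.
Let admU : admissible U := admissible_labels u.

Definition position x : R :=
  sup (labels x) + height x * (next U (labels x) - sup (labels x)).

Let le_initial x : (x <= u)%O -> initial (labels x) U.
Proof. by move=> /point_leP[]. Qed.

Lemma position_ge x : (x <= u)%O -> sup (labels x) <= position x.
Proof.
move=> xu; rewrite lerDl mulr_ge0 ?height_ge0 // subr_ge0.
exact/ltW/sup_lt_next/le_initial.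
Qed.

Lemma position_le x : (x <= u)%O -> position x <= next U (labels x).
Proof.
move=> xu; have := sup_lt_next admU (le_initial xu).
have := height_le1 x; rewrite /position; nra.
Qed.

(** On different edges, the label ending the edge of [x] belongs to [labels y], hence separates the
    positions. If it equals [sup (labels y)], that supremum is attained, and validity makes
    [height y] positive. *)
Lemma position_lt x y : (x <= u)%O -> (y <= u)%O -> (x < y)%O ->
  position x < position y.
Proof.
move=> xu yu; rewrite lt_neqAle => /andP[/eqP nxy /point_leP[ixy hxy]].
have [exy|nexy] := pselect (labels x = labels y).
  have hlt : height x < height y.
    by rewrite lt_neqAle hxy // andbT; apply/eqP => /(point_eq exy).
  have := sup_lt_next admU (le_initial xu).
  rewrite /position -exy; nra.
have yn := next_initial admU ixy (le_initial yu) nexy.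
have admy := admissible_labels y.
have := admissible_sup_ge admy yn.
rewrite le_eqVlt => /orP[/eqP n_sup|]; last first.
  by have := position_le xu; have := position_ge yu; lra.
have hy : 0 < height y.
  by case: (pointP y) => _ _; apply; rewrite /= -n_sup.
apply: le_lt_trans (position_le xu) _; rewrite n_sup ltrDl mulr_gt0 // subr_gt0.
exact/sup_lt_next/le_initial.
Qed.

Lemma position_mono :
  {in [set x | (x <= u)%O] &, {mono position : x y / (x <= y)%O}}.
Proof.
move=> x y; rewrite !inE => xu yu.
have [_ /(_ u x y xu yu)[xy|yx]] := point_tree_order.
  rewrite xy; move: xy; rewrite le_eqVlt => /orP[/eqP->|]; first exact: lexx.
  by move=> /(position_lt xu yu)/ltW.
move: yx; rewrite le_eqVlt => /orP[/eqP->|yx]; first by rewrite !lexx.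
by rewrite (lt_geF yx) (lt_geF (position_lt yu xu yx)).
Qed.

(** The labels of [U] strictly below [p] determine the edge; strictness makes the height positive
    when they have a maximum. *)
Lemma position_surj (p : R) : 0 <= p <= 4 ->
  exists2 x, (x <= u)%O & position x = p.
Proof.
move=> /andP[p0 p4]; pose B := below U p; have iBU := initial_below U p.
have admB : admissible B by apply: admissible_sub admU; case: iBU.
have sp : sup B <= p by apply: sup_le_nonneg => // b [_ /ltW].
have pn : p <= next U B.
  have [BU|nBU] := pselect (B = U); first by rewrite BU next_out.
  have [woU _ _] := admU; have [Un nBn _] := nextP woU iBU nBU.
  by rewrite leNgt; apply/negP => np; apply: nBn.
have sn := sup_lt_next admU iBU.
have sn0 : 0 < next U B - sup B by rewrite subr_gt0.
have [|| x [x1 x2]] := @exists_point B ((p - sup B) / (next U B - sup B)) admB.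
- by rewrite divr_ge0 ?subr_ge0 ?(ltW sn) // ler_pdivrMr // mul1r lerD2r.
- by move=> [_ /= ?]; rewrite divr_gt0 // subr_gt0.
exists x; last by rewrite /position x1 x2 divfK ?gt_eqF // addrC subrK.
by apply/point_leP; rewrite x1 height_u; split=> // _; apply: height_le1.
Qed.

Lemma position_iso :
  order_iso_on [set x | (x <= u)%O] [set` `[0, 4 : R]] position.
Proof.
split; last exact: position_mono.
split.
- move=> x /= xu; rewrite in_itv /=; apply/andP; split.
    apply: le_trans (position_ge xu).
    exact/admissible_sup_ge0/admissible_labels.
  apply: le_trans (position_le xu) _.
  have [->|nxU] := pselect (labels x = U); first by rewrite next_out.
  have [woU U3 _] := admU.
  have [/U3/andP[_]] := nextP woU (le_initial xu) nxU; lra.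
- move=> x y xu yu /eqP; rewrite eq_le !position_mono // => /andP[? ?].
  by apply/eqP; rewrite eq_le; apply/andP.
- move=> p /=; rewrite in_itv /= => /position_surj[x xu <-].
  by exists x.
Qed.

End Position.

Lemma point_branchwise_real : branchwise_real point R.
Proof.
split; [exact: point_tree_order| |exact: point_meet].
move=> D /branch_downset[u [u1 ->]].
by exists `[0, 4 : R]%R, (position u); apply: position_iso.
Qed.

(** * The diagonal argument against gradings *)

Section NoGrading.
Context (l : point -> R).
Hypothesis l_grading : grading l.

(** Admissibility stands inside the existential so that choice yields a function on all sets of
    reals. *)
Lemma exists_point_choice A :
  exists x, admissible A -> labels x = A /\ height x = 1.
Proof.
have [admA|nadmA] := pselect (admissible A).
  by have [x Ax] := exists_point1 admA; exists x.
by have [x _] := exists_point1 (@admissible0 R); exists x.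
Qed.

Let tip A : point := projT1 (cid (exists_point_choice A)).

Let tip_labels A : admissible A -> labels (tip A) = A.
Proof. by rewrite /tip; case: cid => x /= Ax /Ax[]. Qed.

Let tip_height A : admissible A -> height (tip A) = 1.
Proof. by rewrite /tip; case: cid => x /= Ax /Ax[]. Qed.

(** [contract] is increasing with values between [-1] and [1]; the shift by [2] meets the bounds on
    labels. *)
Let F A : R := 2 + contract (l (tip A))%:E.

Let F_bounds A : 1 <= F A <= 3.
Proof.
have := contract_le1 (l (tip A))%:E; rewrite ler_norml /F => /andP[? ?].
by apply/andP; split; lra.
Qed.

(* [c] comes from the midpoint of the edge into the tip of [A]; it keeps
   [A `|` [set F A]] left-discrete when [A] has no maximum. *)
Let F_gap A : admissible A -> exists2 c, c < F A &
  forall B, initial B A -> B <> A -> F B < c.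
Proof.
move=> admA.
have [||x [x1 x2]] := @exists_point A 2^-1 admA; [lra|lra|].
exists (2 + contract (l x)%:E).
  rewrite /F ltrD2l lt_contract lte_fin; apply: l_grading.
  rewrite lt_neqAle; apply/andP; split.
    by apply/eqP => xA; move: x2; rewrite xA tip_height //; lra.
  apply/point_leP; rewrite x1 x2 tip_labels // tip_height //.
  by split=> // _; lra.
move=> B iBA nBA; rewrite /F ltrD2l lt_contract lte_fin; apply: l_grading.
have admB : admissible B by apply: admissible_sub admA; case: iBA.
rewrite lt_neqAle; apply/andP; split.
  by apply/eqP => Bx; apply: nBA; rewrite -x1 -Bx tip_labels.
by apply: le_of_neq; rewrite tip_labels ?x1.
Qed.

Lemma grading_absurd : False.
Proof.
pose good A := admissible A /\ forall a, A a -> a = F (below A a).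
pose U := \bigcup_(A in good) A.
have good_total A B : good A -> good B -> initial A B \/ initial B A.
  by move=> [[woA _ _] gA] [[woB _ _] gB]; apply: (@generated_total _ F).
have admU : admissible U by apply: admissible_bigcup => // A [].
have genU a : U a -> a = F (below U a).
  move=> [A gA Aa]; rewrite (below_initial (initial_bigcup good_total gA)) //.
  by case: gA => _; apply.
have [c cF Fc] := F_gap admU.
have U_lt a : U a -> a < c.
  move=> Ua; rewrite [a]genU //; apply: Fc; first exact: initial_below.
  by move=> E; move: (Ua); rewrite -E => -[_ /=]; rewrite ltxx.
have U_ltF a : U a -> a < F U by move=> /U_lt/lt_trans; apply.
pose V := U `|` [set F U].
have belowU a : U a -> below V a = below U a.
  move=> Ua; apply: below_initial => //; split=> [x Ux|b x Ub [//|->] Fb].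
    by left.
  by have := U_ltF b Ub; rewrite ltNge Fb.
have belowF : below V (F U) = U.
  apply/seteqP; split=> [x [[//|->] /=]|x Ux]; first by rewrite ltxx.
  by split; [left|exact: U_ltF].
(* It remains to see that [V] is itself [good], hence contained in the union [U]. *)
have : U (F U); last by move=> /U_ltF; rewrite ltxx.
exists V; last by right.
split; last first.
  by move=> a [Ua|->]; [rewrite belowU //; apply: genU|rewrite belowF].
split.
(* The least element of [S] lies in [U], unless [S] consists of [F U] alone. *)
- move=> S SV [s Ss]; have [[x SUx]|S0] := pselect ((S `&` U) !=set0).
    have [woU _ _] := admU.
    have [||m [Sm Um] mmin] := woU (S `&` U); [by move=> y []|by exists x|].
    exists m => // y Sy; have [Uy|->] := SV y Sy; first exact: mmin.
    exact/ltW/U_ltF.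
  have SF b : S b -> b = F U.
    by move=> Sb; have [Ub|//] := SV b Sb; case: S0; exists b.
  by exists s => // y Sy; rewrite (SF s) // (SF y).
- move=> a [Ua|->]; first by case: admU => _ + _; apply.
  by have /andP[F1 F3] := F_bounds U; apply/andP; split; lra.
- move=> a [Ua|->]; first by rewrite belowU //; case: admU => _ _; apply.
  by exists c; rewrite // belowF => x /U_lt/ltW.
Qed.

End NoGrading.

End Tree.

Theorem theorem3p1 (R : realType) :
  exists (d : Order.disp_t) (X : porderType d),
    branchwise_real X R /\ ~ continuously_gradable X R.
Proof.
exists point_display, (point R : porderType _).
split; first exact: point_branchwise_real.
by move=> [l [l_grading _]]; apply: grading_absurd l_grading.
Qed.
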